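(* Let $m,n\in\mathbb{N}$ satisfy $1\le m<\frac n3$, and define $f:(S^1,\tau)\to(\mathbb{Z}_n,c_m)$ by $$f(t)=i\quad\text{for } t\in\left[\tfrac{2i-1}{2n},\tfrac{2i+1}{2n}\right),$$ where the interval is understood mod $1$ (and $i$ is understood mod $n$). Then the induced map $f_*:\pi_1(S^1,\tau)\to\pi_1(\mathbb{Z}_n,c_m)$ is an isomorphism.
   Context: A Čech closure space $(X,c)$ is a set $X$ with a map $c:\mathcal{P}(X)\to\mathcal{P}(X)$ such that $c(\emptyset)=\emptyset$, $A\subseteq c(A)$, and $c(A\cup B)=c(A)\cup c(B)$ (not assumed $c^2=c$). A topological space is a closure space via its topological closure. A map $f:(X,c_X)\to(Y,c_Y)$ is continuous iff $f(c_X(A))\subseteq c_Y(f(A))$ for all $A\subseteq X$. $U$ is a neighborhood of $x$ if $x\in X\setminus c(X\setminus U)$. The product closure structure on $X\times Y$ is the one in which, at each point $(x,y)$, the sets $V\times W$ ($V$ a neighborhood of $x$, $W$ a neighborhood of $y$) form a local base of neighborhoods. $(S^1,\tau)$ is the circle $S^1=\mathbb{R}/\mathbb{Z}$ with its usual topological closure. $(\mathbb{Z}_n,c_m)$ is the set $\mathbb{Z}_n=\mathbb{Z}/n\mathbb{Z}$ with $c_m([k])=\{[k-m],\dots,[k],\dots,[k+m]\}$ and $c_m(A)=\bigcup_{[k]\in A}c_m([k])$. $I=[0,1]$ has its usual topology. $\pi_1(X,* )$ is the group of homotopy classes rel $\partial I$ of continuous loops $v:I\to(X,c)$ based at $*$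 (homotopies are continuous maps $I\times I\to (X,c)$ fixed on $\partial I$), with product $[v][w]=[v\star w]$ given by concatenation. The basepoints are $0\in S^1$ and $0=f(0)\in\mathbb{Z}_n$, and $f_*[v]=[f\circ v]$. *)

(* Defs.v *)
From HB Require Import structures.
From mathcomp Require Import all_boot all_order all_algebra.
From mathcomp Require Import all_classical all_reals all_analysis.
From mathcomp Require Import lra.

Set Implicit Arguments.
Unset Strict Implicit.
Unset Printing Implicit Defensive.

Import Order.TTheory GRing.Theory Num.Theory.
Import numFieldNormedType.Exports.

Local Open Scope classical_set_scope.
Local Open Scope ring_scope.
Local Open Scope quotient_scope.

Record closureSpace := ClosureSpace {
  closure_sort :> Type;
  cl : set closure_sort -> set closure_sort;
  cl0 : cl set0 = set0;
  sub_cl : forall A, A `<=` cl A;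
  clU : forall A B, cl (A `|` B) = cl A `|` cl B }.

Definition ccontinuous (X Y : closureSpace) (f : X -> Y) : Prop :=
  forall A : set X, f @` cl A `<=` cl (f @` A).

Definition neighborhood (X : closureSpace) (U : set X) (x : X) : Prop :=
  (~` cl (~` U)) x.

Lemma cl_mono (X : closureSpace) (A B : set X) : A `<=` B -> cl A `<=` cl B.
Proof. by move=> /setUidPr <-; rewrite clU; left. Qed.

Lemma nbhdT (X : closureSpace) (x : X) : neighborhood setT x.
Proof. by rewrite /neighborhood setCT cl0 setC0. Qed.

Lemma nbhdI (X : closureSpace) (U V : set X) (x : X) :
  neighborhood U x -> neighborhood V x -> neighborhood (U `&` V) x.
Proof. by rewrite /neighborhood setCI clU setCU. Qed.

Lemma nbhd_mem (X : closureSpace) (U : set X) (x : X) :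
  neighborhood U x -> U x.
Proof. by move=> nU; apply: contrapT => /(@sub_cl X (~` U)). Qed.

Section TopClosure.
Variable T : topologicalType.

Lemma top_cl0 : closure (@set0 T) = set0. Proof. exact: closure0. Qed.
Lemma top_sub_cl (A : set T) : A `<=` closure A.
Proof. exact: subset_closure. Qed.
Lemma top_clU (A B : set T) : closure (A `|` B) = closure A `|` closure B.
Proof. exact: closureU. Qed.

Definition top_closure : closureSpace :=
  ClosureSpace top_cl0 top_sub_cl top_clU.

Lemma top_nbhdE (U : set T) (x : T) :
  @neighborhood top_closure U x <-> nbhs x U.
Proof.
rewrite /neighborhood /=; split=> [|nU].
  move=> /asboolPn; rewrite -asbool_neg => /asboolP nc.
  apply: contrapT => nU; apply: nc => B nB.
  apply: contrapT => h; apply: nU; apply: filterS nB => y By.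
  by apply: contrapT => nUy; apply: h; exists y.
by move=> /(_ U nU)[y []].
Qed.

End TopClosure.

Lemma continuous_ccontinuous (S T : topologicalType) (f : S -> T) :
  continuous f -> @ccontinuous (top_closure S) (top_closure T) f.
Proof.
move=> cf A _ [x clx <-] B /cf /clx[y [Ay By]].
by exists (f y); split=> //; exists y.
Qed.

Lemma ccontinuous_comp (X Y Z : closureSpace) (g : Y -> Z) (f : X -> Y) :
  ccontinuous f -> ccontinuous g -> ccontinuous (g \o f).
Proof.
move=> cf cg A _ [x clx <-] /=; rewrite -image_comp.
by apply: cg; exists (f x) => //; apply: cf; exists x.
Qed.

Lemma ccontinuous_cst (X Y : closureSpace) (y : Y) :
  @ccontinuous X Y (fun=> y).
Proof.
move=> A _ [x clx <-]; apply: sub_cl; apply: contrapT => h.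
suff A0 : A = set0 by move: clx; rewrite A0 cl0.
by apply/seteqP; split=> // a Aa; apply: h; exists a.
Qed.

(** The product closure: [V `*` W], for neighborhoods [V] of [p.1] and [W] of
    [p.2], is a local base at [p] (see [prod_nbhdP]). *)

Section ProdClosure.
Variables X Y : closureSpace.

Definition prod_cl (A : set (X * Y)) : set (X * Y) :=
  [set p | forall (V : set X) (W : set Y),
    neighborhood V p.1 -> neighborhood W p.2 -> (V `*` W) `&` A !=set0].

Lemma prod_cl0 : prod_cl set0 = set0.
Proof.
apply/seteqP; split=> // p /(_ _ _ (@nbhdT X p.1) (@nbhdT Y p.2)).
by rewrite setI0 => -[].
Qed.

Lemma prod_sub_cl A : A `<=` prod_cl A.
Proof. by move=> p Ap V W /nbhd_mem Vp /nbhd_mem Wp; exists p. Qed.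

Lemma prod_clU A B : prod_cl (A `|` B) = prod_cl A `|` prod_cl B.
Proof.
apply/seteqP; split=> [p clp|p [] clp V W nV nW]; last 2 first.
- by have [q [? ?]] := clp V W nV nW; exists q; split=> //; left.
- by have [q [? ?]] := clp V W nV nW; exists q; split=> //; right.
apply: contrapT => /not_orP[].
move=> /existsNP[V] /existsNP[W] /not_implyP[nV] /not_implyP[nW] hA.
move=> /existsNP[V'] /existsNP[W'] /not_implyP[nV'] /not_implyP[nW'] hB.
have [q [[[Vq V'q] [Wq W'q]] [Aq|Bq]]] := clp _ _ (nbhdI nV nV') (nbhdI nW nW').
- by apply: hA; exists q.
- by apply: hB; exists q.
Qed.

Definition prod_closure : closureSpace :=
  ClosureSpace prod_cl0 prod_sub_cl prod_clU.

Lemma prod_nbhdP (U : set (X * Y)) (p : X * Y) :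
  @neighborhood prod_closure U p <->
  exists V W, [/\ neighborhood V p.1, neighborhood W p.2 & V `*` W `<=` U].
Proof.
split=> [|[V [W [nV nW VWU]]] /(_ V W nV nW)[q [/VWU Uq nUq]] //].
move=> /existsNP[V] /existsNP[W] /not_implyP[nV] /not_implyP[nW] h.
exists V, W; split=> // q VWq; apply: contrapT => Uq.
by apply: h; exists q.
Qed.

End ProdClosure.

Lemma prod_top_cl (S T : topologicalType) (A : set (S * T)) :
  @cl (prod_closure (top_closure S) (top_closure T)) A = closure A.
Proof.
apply/seteqP; split=> p clp.
  move=> B [[V W] /= [nV nW] VWB].
  have [|| q [VWq Aq]] := clp V W; [exact/top_nbhdE|exact/top_nbhdE|].
  by exists q; split=> //; exact: VWB.
move=> V W /top_nbhdE nV /top_nbhdE nW.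
have [|q [Aq VWq]] := clp (V `*` W); first by exists (V, W).
by exists q.
Qed.

Lemma pasting (X Y : closureSpace) (A B : set X) (f g h : X -> Y) :
  cl A `<=` A -> cl B `<=` B -> (forall x, A x \/ B x) ->
  ccontinuous f -> ccontinuous g ->
  (forall x, A x -> h x = f x) -> (forall x, B x -> h x = g x) ->
  ccontinuous h.
Proof.
move=> cA cB AB cf cg hA hB S _ [x clx <-].
have paste C k : cl C `<=` C -> ccontinuous k -> (forall x, C x -> h x = k x) ->
    cl (S `&` C) x -> cl (h @` S) (h x).
  move=> cC ck hC cSC.
  rewrite hC; last by apply: cC; apply: cl_mono cSC; exact: subIsetr.
  apply: (@cl_mono _ (k @` (S `&` C))); last by apply: ck; exists x.
  by move=> _ [y [Sy Cy] <-]; exists y => //; exact: hC.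
have : cl (S `&` A `|` S `&` B) x.
  suff -> : S `&` A `|` S `&` B = S by [].
  by rewrite -setIUr; apply/setIidPl => y _; exact: AB.
by rewrite clU => -[clA|clB]; [exact: (paste A f)|exact: (paste B g)].
Qed.

Section Interval.
Variable R : realType.

(** The subspace topology on [set_type] is the initial one for the inclusion. *)
Definition unitI : topologicalType := `[0%R : R, 1%R]%classic.

Lemma unitI_subproof (x : R) : 0 <= x <= 1 -> x \in (`[0%R, 1%R]%classic : set R).
Proof. by move=> h; rewrite inE /= in_itv. Qed.

Definition mkI (x : R) (h : 0 <= x <= 1) : unitI := exist _ x (unitI_subproof h).

Lemma clamp_subproof (x : R) : 0 <= Num.max 0 (Num.min 1 x) <= 1.
Proof. by rewrite le_max lexx /= ge_max ler01 /= ge_min lexx. Qed.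

Lemma I0_subproof : 0 <= (0 : R) <= 1. Proof. by rewrite lexx ler01. Qed.
Lemma I1_subproof : 0 <= (1 : R) <= 1. Proof. by rewrite lexx ler01. Qed.

Definition I0 : unitI := mkI I0_subproof.
Definition I1 : unitI := mkI I1_subproof.

Definition Ival (s : unitI) : R := \val s.

(** The retraction of [R] onto [0, 1]; the identity on [0, 1] ([clampK]). *)
Definition clamp (x : R) : unitI := mkI (clamp_subproof x).

Lemma Ival_I0 : Ival I0 = 0. Proof. by []. Qed.
Lemma Ival_I1 : Ival I1 = 1. Proof. by []. Qed.

Lemma Ival_inj : injective Ival. Proof. exact: val_inj. Qed.

Lemma Ival_itv (s : unitI) : 0 <= Ival s <= 1.
Proof. by have := set_valP s; rewrite /= in_itv. Qed.

Lemma Ival_clamp (x : R) : Ival (clamp x) = Num.max 0 (Num.min 1 x).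
Proof. by []. Qed.

Lemma clampE (x : R) : 0 <= x <= 1 -> Ival (clamp x) = x.
Proof. by move=> /andP[x0 x1]; rewrite Ival_clamp min_r// max_r. Qed.

Lemma clampK : cancel Ival clamp.
Proof. by move=> s; apply: Ival_inj; rewrite clampE// Ival_itv. Qed.

Lemma clamp_ge1 (x : R) : 1 <= x -> clamp x = I1.
Proof. by move=> h; apply: Ival_inj; rewrite Ival_clamp min_l// max_r. Qed.

Lemma clamp_le0 (x : R) : x <= 0 -> clamp x = I0.
Proof.
move=> h; apply: Ival_inj; rewrite Ival_clamp.
by rewrite min_r ?max_l//; exact: le_trans h ler01.
Qed.

Lemma Ival_continuous : continuous Ival.
Proof. exact: initial_continuous. Qed.

Lemma clamp_continuous : continuous clamp.
Proof.
apply: continuous_comp_initial => x.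
apply: (@continuous_max R R (fun=> 0) (fun y => Num.min 1 y)); first exact: cvg_cst.
by apply: (@continuous_min R R (fun=> 1) id); [exact: cvg_cst|exact: cvg_id].
Qed.

End Interval.

Lemma ccontinuous_prodE (S T : topologicalType) (X : closureSpace)
    (h : S * T -> X) :
  @ccontinuous (prod_closure (top_closure S) (top_closure T)) X h <->
  @ccontinuous (top_closure (S * T)%type) X h.
Proof. by split=> ch A; have := ch A; rewrite prod_top_cl. Qed.

Section Paths.
Variables (R : realType) (X : closureSpace).
Local Notation I := (unitI R).

Lemma ccontinuous_clamp (T : topologicalType) (a : I -> X) (phi : T -> R) :
  @ccontinuous (top_closure I) X a -> continuous phi ->
  @ccontinuous (top_closure T) X (fun s => a (clamp (phi s))).
Proof.
move=> ca cphi.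
apply: (@ccontinuous_comp (top_closure T) (top_closure I) X a) => //.
apply: continuous_ccontinuous => s; apply: continuous_comp; first exact: cphi.
exact: clamp_continuous.
Qed.

Lemma ccontinuous_clamp2 (T : topologicalType) (h : I * I -> X) (f g : T -> R) :
  @ccontinuous (top_closure (I * I)%type) X h -> continuous f -> continuous g ->
  @ccontinuous (top_closure T) X (fun s => h (clamp (f s), clamp (g s))).
Proof.
move=> ch cf cg.
apply: (@ccontinuous_comp (top_closure T) (top_closure (I * I)%type) X h) => //.
apply: continuous_ccontinuous => s.
apply: (@cvg_pair _ _ _ _ (nbhs (clamp (f s))) (nbhs (clamp (g s)))).
  by apply: continuous_comp; [exact: cf|exact: clamp_continuous].
by apply: continuous_comp; [exact: cg|exact: clamp_continuous].
Qed.

Lemma ccontinuous_if (T : topologicalType) (phi : T -> R) (f g : T -> X) :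
  continuous phi ->
  @ccontinuous (top_closure T) X f -> @ccontinuous (top_closure T) X g ->
  (forall t, phi t = 2^-1 -> f t = g t) ->
  @ccontinuous (top_closure T) X (fun t => if phi t <= 2^-1 then f t else g t).
Proof.
move=> cphi cf cg fg.
apply: (@pasting (top_closure T) X (phi @^-1` [set x | x <= 2^-1])
  (phi @^-1` [set x | 2^-1 <= x]) f g) => //=.
- by apply: (@closed_comp _ _ phi) => [? _|]; [exact: cphi|exact: closed_le].
- by apply: (@closed_comp _ _ phi) => [? _|]; [exact: cphi|exact: closed_ge].
- by move=> t; apply/orP; exact: le_total.
- by move=> t ->.
- move=> t; case: ifPn => // h1 h2; apply: fg.
  by apply/eqP; rewrite eq_le h1 h2.
Qed.

End Paths.

Section Loops.
Variables (R : realType) (X : closureSpace) (x0 : X).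
Local Notation I := (unitI R).

Record loop := Loop {
  loop_fun :> I -> X;
  loop_continuous : @ccontinuous (top_closure I) X loop_fun;
  loop0 : loop_fun (I0 R) = x0;
  loop1 : loop_fun (I1 R) = x0 }.

HB.instance Definition _ := gen_eqMixin loop.
HB.instance Definition _ := gen_choiceMixin loop.

Definition homotopic (v w : loop) : Prop :=
  exists H : I * I -> X,
  [/\ @ccontinuous (prod_closure (top_closure I) (top_closure I)) X H,
      forall s, H (s, I0 R) = v s,
      forall s, H (s, I1 R) = w s,
      forall t, H (I0 R, t) = x0 &
      forall t, H (I1 R, t) = x0].

Let Ival1 : continuous (fun p : I * I => Ival p.1).
Proof.
by move=> p; apply: (@continuous_comp _ _ _ fst); [exact: cvg_fst|exact: Ival_continuous].
Qed.

Let Ival2 : continuous (fun p : I * I => Ival p.2).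
Proof.
by move=> p; apply: (@continuous_comp _ _ _ snd); [exact: cvg_snd|exact: Ival_continuous].
Qed.

Let half0 : (Ival (I0 R) <= 2^-1) = true.
Proof. by rewrite Ival_I0 invr_ge0 ler0n. Qed.

Let half1 : (Ival (I1 R) <= 2^-1) = false.
Proof. by rewrite Ival_I1; apply/negbTE; rewrite -ltNge; lra. Qed.

Let clamp_double0 : clamp (2 * Ival (I0 R)) = I0 R.
Proof. by rewrite Ival_I0 mulr0 clamp_le0. Qed.

Let clamp_double1 : clamp (2 * Ival (I1 R) - 1) = I1 R.
Proof. by rewrite clamp_ge1// Ival_I1; lra. Qed.

Let affine (T : topologicalType) (f : T -> R) (a b : R) :
  continuous f -> continuous (fun t => a * f t + b).
Proof.
move=> cf t; apply: cvgD; last exact: cvg_cst.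
by apply: cvgM; [exact: cvg_cst|exact: cf].
Qed.

Let double (T : topologicalType) (f : T -> R) :
  continuous f -> continuous (fun t => 2 * f t).
Proof. by move=> cf t; apply: cvgM; [exact: cvg_cst|exact: cf]. Qed.

Let doubleB1 (T : topologicalType) (f : T -> R) :
  continuous f -> continuous (fun t => 2 * f t - 1).
Proof. exact: affine. Qed.

Let onem (T : topologicalType) (f : T -> R) :
  continuous f -> continuous (fun t => 1 - f t).
Proof. by move=> cf t; apply: cvgB; [exact: cvg_cst|exact: cf]. Qed.

Lemma homotopic_refl v : homotopic v v.
Proof.
exists (fun p => v p.1); split=> [||t|t|t]; rewrite ?loop0 ?loop1//.
apply/ccontinuous_prodE.
have := ccontinuous_clamp (@loop_continuous v) Ival1.
by congr ccontinuous; apply/funext => p; rewrite clampK.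
Qed.

Lemma homotopic_sym v w : homotopic v w -> homotopic w v.
Proof.
move=> [H [/ccontinuous_prodE cH H0 H1 Hl Hr]].
exists (fun p => H (clamp (Ival p.1), clamp (1 - Ival p.2))); split=> [|s|s|t|t].
- apply/ccontinuous_prodE; apply: ccontinuous_clamp2 => //.
  by move=> p; apply: cvgB; [exact: cvg_cst|exact: Ival2].
- by rewrite clampK subr0 clamp_ge1.
- by rewrite clampK subrr clamp_le0.
- by rewrite clampK.
- by rewrite clampK.
Qed.

Lemma homotopic_trans u v w : homotopic u v -> homotopic v w -> homotopic u w.
Proof.
move=> [H [/ccontinuous_prodE cH H0 H1 Hl Hr]].
move=> [K [/ccontinuous_prodE cK K0 K1 Kl Kr]].
exists (fun p => if Ival p.2 <= 2^-1 then H (clamp (Ival p.1), clamp (2 * Ival p.2))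
  else K (clamp (Ival p.1), clamp (2 * Ival p.2 - 1))); split=> [|s|s|t|t].
- apply/ccontinuous_prodE; apply: (ccontinuous_if Ival2).
  + exact: ccontinuous_clamp2 cH Ival1 (double Ival2).
  + exact: ccontinuous_clamp2 cK Ival1 (doubleB1 Ival2).
  + by move=> p ->; rewrite clampK mulfV// subrr clamp_ge1// clamp_le0// H1 K0.
- by rewrite /= half0 clampK clamp_double0 H0.
- by rewrite /= half1 clampK clamp_double1 K1.
- by case: ifP; rewrite clampK.
- by case: ifP; rewrite clampK.
Qed.

Canonical loop_equiv := EquivRel (fun v w => `[< homotopic v w >])
  (fun v => asboolT (homotopic_refl v))
  (fun v w => asbool_equiv_eq
     (conj (@homotopic_sym v w) (@homotopic_sym w v)))
  (fun v u w uv vw => asboolT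
     (homotopic_trans (asboolW uv) (asboolW vw))).

(** [v] on the first half of the interval, then [w]; on [0, 1] [clamp] is the
    identity, so the two branches are [v (2 s)] and [w (2 s - 1)]. *)
Definition concat_fun (v w : I -> X) (s : I) : X :=
  if Ival s <= 2^-1 then v (clamp (2 * Ival s)) else w (clamp (2 * Ival s - 1)).

Lemma concat_continuous (v w : loop) :
  @ccontinuous (top_closure I) X (concat_fun v w).
Proof.
apply: ccontinuous_if; first exact: Ival_continuous.
- exact: ccontinuous_clamp (@loop_continuous v) (double (@Ival_continuous R)).
- exact: ccontinuous_clamp (@loop_continuous w) (doubleB1 (@Ival_continuous R)).
- by move=> s ->; rewrite mulfV// subrr clamp_ge1// clamp_le0// loop0 loop1.
Qed.

Lemma concat0 (v w : loop) : concat_fun v w (I0 R) = x0.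
Proof. by rewrite /concat_fun half0 clamp_double0 loop0. Qed.

Lemma concat1 (v w : loop) : concat_fun v w (I1 R) = x0.
Proof.
by rewrite /concat_fun half1 clamp_double1 loop1.
Qed.

Definition concat (v w : loop) : loop :=
  Loop (@concat_continuous v w) (concat0 v w) (concat1 v w).

Lemma rev_continuous (v : loop) :
  @ccontinuous (top_closure I) X (fun s => v (clamp (1 - Ival s))).
Proof.
apply: (ccontinuous_clamp (phi := fun s => 1 - Ival s) (@loop_continuous v)).
exact: (onem (@Ival_continuous R)).
Qed.

Lemma rev0 (v : loop) : v (clamp (1 - Ival (I0 R))) = x0.
Proof. by rewrite Ival_I0 subr0 clamp_ge1// loop1. Qed.

Lemma rev1 (v : loop) : v (clamp (1 - Ival (I1 R))) = x0.
Proof. by rewrite Ival_I1 subrr clamp_le0// loop0. Qed.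

Definition rev_loop (v : loop) : loop :=
  Loop (@rev_continuous v) (rev0 v) (rev1 v).

Definition cst_loop : loop :=
  Loop (@ccontinuous_cst (top_closure I) X x0) erefl erefl.

Lemma homotopic_concat v v' w w' :
  homotopic v v' -> homotopic w w' -> homotopic (concat v w) (concat v' w').
Proof.
move=> [H [/ccontinuous_prodE cH H0 H1 Hl Hr]].
move=> [K [/ccontinuous_prodE cK K0 K1 Kl Kr]].
exists (fun p => if Ival p.1 <= 2^-1 then H (clamp (2 * Ival p.1), clamp (Ival p.2))
  else K (clamp (2 * Ival p.1 - 1), clamp (Ival p.2))); split=> [|s|s|t|t].
- apply/ccontinuous_prodE; apply: (ccontinuous_if Ival1).
  + exact: ccontinuous_clamp2 cH (double Ival1) Ival2.
  + exact: ccontinuous_clamp2 cK (doubleB1 Ival1) Ival2.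
  + by move=> p ->; rewrite clampK mulfV// subrr clamp_ge1// clamp_le0// Hr Kl.
- by rewrite /= /concat_fun; case: ifP; rewrite clampK ?H0 ?K0.
- by rewrite /= /concat_fun; case: ifP; rewrite clampK ?H1 ?K1.
- by rewrite /= half0 clamp_double0 clampK Hl.
- by rewrite /= half1 clamp_double1 clampK Kr.
Qed.

Lemma homotopic_reparam (v w w' : loop) (phi psi : I -> R) :
  continuous phi -> continuous psi ->
  (forall s, w s = v (clamp (phi s))) -> (forall s, w' s = v (clamp (psi s))) ->
  phi (I0 R) = psi (I0 R) -> phi (I1 R) = psi (I1 R) -> homotopic w w'.
Proof.
move=> cphi cpsi wE w'E e0 e1.
exists (fun p => v (clamp ((1 - Ival p.2) * phi p.1 + Ival p.2 * psi p.1))).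
split=> [|s|s|t|t] /=.
- apply/ccontinuous_prodE; apply: ccontinuous_clamp (@loop_continuous v) _.
  have cp1 (f : I -> R) : continuous f -> continuous (fun p : I * I => f p.1).
    by move=> cf p; apply: (@continuous_comp _ _ _ fst); [exact: cvg_fst|exact: cf].
  move=> p; apply: cvgD; apply: cvgM.
  + by apply: cvgB; [exact: cvg_cst|exact: Ival2].
  + exact: cp1.
  + exact: Ival2.
  + exact: cp1.
- by rewrite subr0 mul1r mul0r addr0 wE.
- by rewrite subrr mul1r mul0r add0r w'E.
- by rewrite -e0 -mulrDl subrK mul1r -wE loop0.
- by rewrite -e1 -mulrDl subrK mul1r -wE loop1.
Qed.

Let cI : continuous (@Ival R) := @Ival_continuous R.

Let cmin (f g : I -> R) : continuous f -> continuous g ->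
  continuous (fun s => Num.min (f s) (g s)).
Proof. by move=> cf cg s; apply: (@continuous_min R _ f g); [exact: cf|exact: cg]. Qed.

Let cmax (f g : I -> R) : continuous f -> continuous g ->
  continuous (fun s => Num.max (f s) (g s)).
Proof. by move=> cf cg s; apply: (@continuous_max R _ f g); [exact: cf|exact: cg]. Qed.

Let ccst (c : R) : continuous (fun _ : I => c).
Proof. exact: (@cst_continuous I R c). Qed.

Let concatE (v w : loop) (x : R) : 0 <= x <= 1 -> concat v w (clamp x) =
  if x <= 2^-1 then v (clamp (2 * x)) else w (clamp (2 * x - 1)).
Proof. by move=> x01; rewrite /= /concat_fun clampE. Qed.

Lemma homotopic_concatA u v w :
  homotopic (concat (concat u v) w) (concat u (concat v w)).
Proof.
pose phi (s : I) := Num.min (2 * Ival s)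
  (Num.min (1 * Ival s + 4^-1) (2^-1 * Ival s + 2^-1)).
apply: (@homotopic_reparam (concat u (concat v w)) _ _ phi (@Ival R)) => //.
- by apply: cmin; [exact: double|apply: cmin; exact: affine].
- move=> s; have sI := Ival_itv s; rewrite -[in LHS](clampK s).
  have phiI : 0 <= phi s <= 1.
    by rewrite /phi; case: (leP (_ + 4^-1) (_ + 2^-1)) => ?; case: (leP (2 * _)) => ?; lra.
  rewrite [LHS]concatE// [RHS]concatE//.
  have [s2|s2] := leP (Ival s) 2^-1.
    rewrite concatE; last by lra.
    have [s4|s4] := leP (2 * Ival s) 2^-1.
      have -> : phi s = 2 * Ival s.
        by rewrite /phi; case: (leP (_ + 4^-1) (_ + 2^-1)) => ?; case: (leP (2 * _)) => ?; lra.
      by rewrite s4.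
    have -> : phi s = Ival s + 4^-1.
      by rewrite /phi; case: (leP (_ + 4^-1) (_ + 2^-1)) => ?; case: (leP (2 * _)) => ?; lra.
    rewrite ifN; last by rewrite -ltNge; lra.
    rewrite concatE; last by lra.
    rewrite ifT; last by lra.
    by congr (v (clamp _)); lra.
  have -> : phi s = 2^-1 * Ival s + 2^-1.
    by rewrite /phi; case: (leP (_ + 4^-1) (_ + 2^-1)) => ?; case: (leP (2 * _)) => ?; lra.
  rewrite ifN; last by rewrite -ltNge; lra.
  rewrite concatE; last by lra.
  rewrite ifN; last by rewrite -ltNge; lra.
  by congr (w (clamp _)); lra.
- by move=> s; rewrite clampK.
- by rewrite /phi Ival_I0; case: (leP (_ + 4^-1) (_ + 2^-1)) => ?; case: (leP (2 * _)) => ?; lra.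
- by rewrite /phi Ival_I1; case: (leP (_ + 4^-1) (_ + 2^-1)) => ?; case: (leP (2 * _)) => ?; lra.
Qed.

Lemma homotopic_concat1l v : homotopic (concat cst_loop v) v.
Proof.
apply: (@homotopic_reparam v _ _ (fun s => Num.max 0 (2 * Ival s - 1)) (@Ival R)).
- by apply: cmax => //; exact: doubleB1.
- exact: cI.
- move=> s; rewrite /= /concat_fun; case: leP => s2.
    by rewrite max_l ?clamp_le0 ?loop0//; lra.
  by rewrite max_r//; lra.
- by move=> s; rewrite clampK.
- by rewrite Ival_I0 max_l//; lra.
- by rewrite Ival_I1 max_r//; lra.
Qed.

Lemma homotopic_concat1r v : homotopic (concat v cst_loop) v.
Proof.
apply: (@homotopic_reparam v _ _ (fun s => Num.min 1 (2 * Ival s)) (@Ival R)).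
- by apply: cmin => //; exact: double.
- exact: cI.
- move=> s; rewrite /= /concat_fun; case: leP => s2.
    by rewrite min_r//; lra.
  by rewrite min_l ?clamp_ge1 ?loop1//; lra.
- by move=> s; rewrite clampK.
- by rewrite Ival_I0 min_r//; lra.
- by rewrite Ival_I1 min_l//; lra.
Qed.

Lemma homotopic_concatVl v : homotopic (concat (rev_loop v) v) cst_loop.
Proof.
apply: (@homotopic_reparam v _ _
  (fun s => Num.max (- 2 * Ival s + 1) (2 * Ival s - 1)) (fun=> 1)) => //.
- by apply: cmax; exact: affine.
- move=> s; have sI := Ival_itv s; rewrite [LHS]/= /concat_fun; case: leP => s2.
    rewrite /rev_loop [LHS]/= clampE; last by lra.
    by rewrite max_l; [congr (v (clamp _)); lra|lra].
  by rewrite max_r//; lra.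
- by move=> s; rewrite clamp_ge1// loop1.
- by rewrite Ival_I0 max_l; lra.
- by rewrite Ival_I1 max_r; lra.
Qed.

Lemma homotopic_concatVr v : homotopic (concat v (rev_loop v)) cst_loop.
Proof.
apply: (@homotopic_reparam v _ _
  (fun s => Num.min (2 * Ival s) (- 2 * Ival s + 2)) (fun=> 0)) => //.
- by apply: cmin; [exact: double|exact: affine].
- move=> s; have sI := Ival_itv s; rewrite [LHS]/= /concat_fun; case: leP => s2.
    by rewrite min_l//; lra.
  rewrite /rev_loop [LHS]/= clampE; last by lra.
  by rewrite min_r; [congr (v (clamp _)); lra|lra].
- by move=> s; rewrite clamp_le0// loop0.
- by rewrite Ival_I0 min_l; lra.
- by rewrite Ival_I1 min_r; lra.
Qed.

Lemma homotopic_rev v w : homotopic v w -> homotopic (rev_loop v) (rev_loop w).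
Proof.
move=> [H [/ccontinuous_prodE cH H0 H1 Hl Hr]].
exists (fun p => H (clamp (1 - Ival p.1), clamp (Ival p.2))); split=> [|s|s|t|t].
- apply/ccontinuous_prodE; apply: ccontinuous_clamp2 => //.
  by move=> p; apply: cvgB; [exact: cvg_cst|exact: Ival1].
- by rewrite clampK H0.
- by rewrite clampK H1.
- by rewrite clampK subr0 clamp_ge1.
- by rewrite clampK subrr clamp_le0.
Qed.

Definition pi1 : Type := {eq_quot loop_equiv}.
HB.instance Definition _ := Choice.on pi1.
HB.instance Definition _ := EqQuotient.on pi1.

Lemma pi1P (v w : loop) : \pi_pi1 v = \pi_pi1 w <-> homotopic v w.
Proof.
change (v = w %[mod {eq_quot loop_equiv}] <-> homotopic v w).
split=> [/eqmodP/asboolP//|vw]; exact/eqmodP/asboolP.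
Qed.

(** [pi1_mulE], [pi1_invE] and [pi1_mapE] below: these choices of
    representatives are immaterial. *)
Definition pi1_one : pi1 := \pi_pi1 cst_loop.
Definition pi1_inv (a : pi1) : pi1 := \pi_pi1 (rev_loop (repr a)).
Definition pi1_mul (a b : pi1) : pi1 := \pi_pi1 (concat (repr a) (repr b)).

Lemma pi1_invE (v : loop) : pi1_inv (\pi_pi1 v) = \pi_pi1 (rev_loop v).
Proof. by apply/pi1P/homotopic_rev/pi1P; rewrite reprK. Qed.

Lemma pi1_mulE (v w : loop) : pi1_mul (\pi_pi1 v) (\pi_pi1 w) = \pi_pi1 (concat v w).
Proof. by apply/pi1P/homotopic_concat; apply/pi1P; rewrite reprK. Qed.

Lemma pi1_mulA : associative pi1_mul.
Proof.
elim/quotW=> u; elim/quotW=> v; elim/quotW=> w; rewrite (pi1_mulE u v) (pi1_mulE v w) !pi1_mulE.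
by apply/esym/pi1P; exact: homotopic_concatA.
Qed.

Lemma pi1_mul1g : left_id pi1_one pi1_mul.
Proof.
by elim/quotW=> v; rewrite pi1_mulE; exact/pi1P/homotopic_concat1l.
Qed.

Lemma pi1_mulg1 : right_id pi1_one pi1_mul.
Proof.
by elim/quotW=> v; rewrite pi1_mulE; exact/pi1P/homotopic_concat1r.
Qed.

Lemma pi1_mulVg : left_inverse pi1_one pi1_inv pi1_mul.
Proof.
elim/quotW=> v; rewrite pi1_invE pi1_mulE.
exact/pi1P/homotopic_concatVl.
Qed.

Lemma pi1_mulgV : right_inverse pi1_one pi1_inv pi1_mul.
Proof.
elim/quotW=> v; rewrite pi1_invE pi1_mulE.
exact/pi1P/homotopic_concatVr.
Qed.

HB.instance Definition _ := isGroup.Build pi1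
  pi1_mulA pi1_mul1g pi1_mulg1 pi1_mulVg pi1_mulgV.

End Loops.

Arguments loop_continuous {R X x0} l A t _.

Section InducedMap.
Variables (R : realType) (X Y : closureSpace) (f : X -> Y).
Hypothesis cf : ccontinuous f.
Variables (x0 : X) (y0 : Y).
Hypothesis fx0 : f x0 = y0.

Lemma comp_loop0 (v : loop R x0) : (f \o v) (I0 R) = y0.
Proof. by rewrite /= loop0. Qed.

Lemma comp_loop1 (v : loop R x0) : (f \o v) (I1 R) = y0.
Proof. by rewrite /= loop1. Qed.

Definition comp_loop (v : loop R x0) : loop R y0 :=
  Loop (ccontinuous_comp (loop_continuous v) cf) (comp_loop0 v) (comp_loop1 v).

Lemma homotopic_comp (v w : loop R x0) :
  homotopic v w -> homotopic (comp_loop v) (comp_loop w).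
Proof.
move=> [H [cH H0 H1 Hl Hr]]; exists (f \o H).
split=> [|s|s|t|t] /=; first exact: ccontinuous_comp cH cf.
- by rewrite H0.
- by rewrite H1.
- by rewrite Hl.
- by rewrite Hr.
Qed.

Definition pi1_map (a : pi1 R x0) : pi1 R y0 := \pi_(pi1 R y0) (comp_loop (repr a)).

Lemma pi1_mapE (v : loop R x0) :
  pi1_map (\pi_(pi1 R x0) v) = \pi_(pi1 R y0) (comp_loop v).
Proof. by apply/pi1P/homotopic_comp/pi1P; rewrite reprK. Qed.

End InducedMap.

Definition group_isomorphism (G H : groupType) (phi : G -> H) : Prop :=
  {morph phi : x y / (x * y)%g >-> (x * y)%g} /\ bijective phi.

Section Circle.
Variable R : realType.

Definition circle_rel : rel R := fun x y => x - y \is a Num.int.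

Lemma circle_rel_refl : reflexive circle_rel.
Proof. by move=> x; rewrite /circle_rel subrr rpred0. Qed.

Lemma circle_rel_sym : symmetric circle_rel.
Proof. by move=> x y; rewrite /circle_rel -opprB rpredN. Qed.

Lemma circle_rel_trans : transitive circle_rel.
Proof. by move=> y x z xy yz; rewrite /circle_rel -(subrKA y) rpredD. Qed.

Canonical circle_equiv :=
  EquivRel circle_rel circle_rel_refl circle_rel_sym circle_rel_trans.

Definition circle : topologicalType := quotient_topology {eq_quot circle_equiv}.

Definition to_circle (t : R) : circle :=
  \pi_(quotient_topology {eq_quot circle_equiv}) t.

Lemma to_circleP (s t : R) :
  to_circle s = to_circle t <-> exists k : int, s - t = k%:~R.
Proof.
change (s = t %[mod {eq_quot circle_equiv}] <-> exists k : int, s - t = k%:~R).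
by split=> [/eqmodP/intrP//|/intrP st]; exact/eqmodP.
Qed.

Definition circle_closure : closureSpace := top_closure circle.

End Circle.

Section Cyclic.
Variables n m : nat.

(** The classes [k - m], ..., [k + m]. ['Z_n] has [n] elements for [1 < n]. *)
Definition Zn_ball (k : 'Z_n) : set 'Z_n :=
  [set k + d%:~R | d in [set d : int | `|d| <= m%:Z]].

Definition Zn_cl (A : set 'Z_n) : set 'Z_n := \bigcup_(k in A) Zn_ball k.

Lemma Zn_cl0 : Zn_cl set0 = set0. Proof. exact: bigcup_set0. Qed.

Lemma Zn_sub_cl A : A `<=` Zn_cl A.
Proof. by move=> k Ak; exists k => //; exists 0; rewrite /= ?normr0 ?addr0. Qed.

Lemma Zn_clU A B : Zn_cl (A `|` B) = Zn_cl A `|` Zn_cl B.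
Proof. exact: bigcup_setU. Qed.

Definition Zn_closure : closureSpace := ClosureSpace Zn_cl0 Zn_sub_cl Zn_clU.

End Cyclic.

(** The map of the main theorem exists; it is unique, since the intervals cover
    [R]. *)
Lemma circle_round_exists (R : realType) (n : nat) : (1 < n)%N ->
  exists f : circle R -> 'Z_n, forall (i : int) (t : R),
    (2 * i - 1)%:~R / (2 * n)%:R <= t < (2 * i + 1)%:~R / (2 * n)%:R ->
    f (to_circle t) = i%:~R.
Proof.
move=> n1; exists (fun x => (Num.floor (n%:R * repr x + 2^-1))%:~R) => i t.
have n0 : 0 < n%:R :> R by rewrite ltr0n ltnW.
rewrite natrM ler_pdivrMr ?ltr_pdivlMr ?mulr_gt0// intrB intrD !intrM.
move=> /andP[t1 t2].
have [k rtk] : exists k : int, repr (to_circle t) - t = k%:~R.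
  by apply/to_circleP; rewrite /to_circle reprK.
have -> : repr (to_circle t) = t + k%:~R by rewrite -rtk addrC subrK.
rewrite (_ : Num.floor _ = i + n%:Z * k); last first.
  apply: floor_def; rewrite !intrD !intrM -!pmulrn; apply/andP; split; nra.
by rewrite intrD intrM -pmulrn pchar_Zp// mul0r addr0.
Qed.

(* Main.v *)
Require Import Defs.
From mathcomp Require Import all_boot all_order all_algebra.
From mathcomp Require Import all_classical all_reals all_analysis.
From mathcomp Require Import lra.

Set Implicit Arguments.
Unset Strict Implicit.
Unset Printing Implicit Defensive.

Import Order.TTheory GRing.Theory Num.Theory.
Import numFieldNormedType.Exports.

Local Open Scope classical_set_scope.
Local Open Scope ring_scope.

(** Both groups are read off from lifts.  A loop in the circle lifts along
    [to_circle] to a real function starting at 0, and a loop in [(Z_n, c_m)]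
    lifts along reduction modulo [n] to an integer function starting at 0 whose
    values change locally by at most [m].  In both cases the endpoint of the
    lift decides the homotopy class, and if [a] lifts a loop [v] of the circle
    then rounding [n * a] to the nearest integer lifts [f \o v], so [f]
    multiplies endpoints by [n].  Since the endpoints are the integers on one
    side and the multiples of [n] on the other, [f] induces a bijection.  It is
    a morphism because composing with [f] commutes with concatenation.

    The lifting theory is done once ([path_lift], [lift_unique]), for functions
    with values in an ordered domain that are only controlled modulo a period
    [N] and up to jumps of size [rho]; it serves the circle (real values,
    [N = 1], [rho = 1/4]) and the cyclic space (integer values, [N = n],
    [rho = m]).  Its essential requirement is [3 rho < N]: two points of a common
    neighborhood, both compared with its center, and the jump between them
    add up to at most [3 rho], which must not be a nonzero period.  This is
    where the hypothesis [m < n / 3] enters.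

    - Homotopic loops of [(Z_n, c_m)] have lifts with the same endpoint
      ([lift_end_homotopic]): lift each path [t |-> H (s, t)] separately; these
      lifts fit together ([family_lift_jumps]), and they are constant on the
      two sides where [H] is.
    - Loops of [(Z_n, c_m)] whose lifts end at the same point are homotopic
      ([lift_homotopic]): integer lifts can be deformed into each other through
      minima and maxima with constants, which never enlarge jumps.
    - Loops of the circle whose lifts have the same end are homotopic by
      straight lines upstairs ([circle_lift_homotopic]). *)

(** * Functions with bounded jumps, and congruence modulo a period *)

Definition congr_mod (E : realDomainType) (N x y : E) : Prop :=
  exists k : int, x = y + N *~ k.

(** For integer values, the domain being all of [T], this is continuity into the
    integers with the closure that adds everything within distance [rho]. *)
Definition jumps_le (T : topologicalType) (E : realDomainType) (A : set T)
    (rho : E) (a : T -> E) : Prop :=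
  forall x, A x -> \forall y \near x, `|a y - a x| <= rho.

(** The relation that continuity into [(Z_n, c_m)] gives between representatives
    of nearby values ([congr_near_Zn]), and which closeness in the circle gives
    between real representatives. *)
Definition congr_near (E : realDomainType) (N rho x y : E) : Prop :=
  exists2 z, congr_mod N z y & `|z - x| <= rho.

(** The points of [A] satisfying [P] form a relatively clopen set.  All lifting
    arguments below are instances of this principle, instead of subdivisions of
    the interval. *)
Lemma local_propagation (T : topologicalType) (A : set T) (P : T -> Prop) :
  connected A ->
  (forall x, A x -> exists2 U, nbhs x U &
    forall y z, A y -> A z -> U y -> U z -> P y -> P z) ->
  forall x y, A x -> A y -> P x -> P y.
Proof.
move=> cA prop x y Ax Ay Px.
suff : A `&` [set z | P z] = A by move=> /seteqP[_ /(_ y Ay)[]].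
apply: cA; first by exists x.
- exists (interior [set z | A z -> P z]); first exact: open_interior.
  apply/seteqP; split=> z [Az Pz]; split=> //.
    have [U nU UP] := prop z Az.
    by apply: (filterS _ nU) => w Uw Aw; apply: (UP z w) => //; exact: nbhs_singleton nU.
  by move: Pz => /(@nbhs_singleton _ _ _); apply.
- exists (closure (A `&` [set z | P z])); first exact: closed_closure.
  apply/seteqP; split=> z [Az Pz]; split=> //; first exact: subset_closure.
  have [U nU UP] := prop z Az; have [w [[Aw Pw] Uw]] := Pz U nU.
  by apply: (UP w z) => //; exact: nbhs_singleton nU.
Qed.

Section Congruence.
Variables (E : realDomainType) (N : E).

Lemma congr_mod_sym x y : congr_mod N x y -> congr_mod N y x.
Proof. by move=> [k ->]; exists (- k); rewrite mulrNz addrK. Qed.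

Lemma congr_mod_trans y x z : congr_mod N x y -> congr_mod N y z -> congr_mod N x z.
Proof. by move=> [k ->] [l ->]; exists (l + k); rewrite mulrzDr addrA. Qed.

Lemma congr_mod_add x y t : congr_mod N x y -> congr_mod N (x + t) (y + t).
Proof. by move=> [k ->]; exists k; rewrite addrAC. Qed.

Lemma congr_mod_eq x y : congr_mod N x y -> `|x - y| < N -> x = y.
Proof.
move=> [k ->]; rewrite addrC addKr; have [->|k0] := eqVneq k 0.
  by rewrite mulr0z addr0.
rewrite -mulrzl normrM => h; suff : N < N by rewrite ltxx.
apply: (le_lt_trans _ h); have N0 : 0 <= N.
  by apply/ltW/(le_lt_trans _ h); rewrite mulr_ge0.
rewrite (ger0_norm N0) ler_peMl// -intr_norm -[1]/(1%:~R) ler_int.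
by rewrite -gtz0_ge1 normr_gt0.
Qed.

End Congruence.

(** * Uniqueness and local existence of lifts *)

Section Lifts.
Variables (E : realDomainType) (N rho : E).

(** Two congruent lifts are compared through the center [y] of a neighborhood:
    if they agree somewhere near [y] they differ by at most [2 rho] at [y],
    hence agree at [y], hence differ by at most [2 rho] nearby. *)
Lemma lift_unique (T : topologicalType) (A : set T) (a b : T -> E) (x0 : T) :
  connected A -> rho + rho < N -> jumps_le A rho a -> jumps_le A rho b ->
  (forall x, A x -> congr_mod N (a x) (b x)) -> A x0 -> a x0 = b x0 ->
  forall x, A x -> a x = b x.
Proof.
move=> cA rN ja jb ab Ax0 ab0 x Ax.
apply: (local_propagation (P := fun x => a x = b x) cA _ Ax0 Ax ab0).
move=> y Ay; exists [set z | `|a z - a y| <= rho /\ `|b z - b y| <= rho].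
  by apply: filterI; [exact: ja|exact: jb].
have close z : A z -> `|a z - b z| <= rho + rho -> a z = b z.
  by move=> Az h; apply: (congr_mod_eq (ab z Az)); exact: le_lt_trans h rN.
move=> z w Az Aw /= [az bz] [aw bw] abz.
have aby : a y = b y by apply: close => //; rewrite !ler_norml in az bz *; lra.
by apply: close => //; rewrite !ler_norml in aw bw *; lra.
Qed.

Lemma congr_near_recenter (c x y : E) :
  congr_mod N c x -> congr_near N rho x y -> congr_near N rho c y.
Proof.
move=> cx [z zy zx]; exists (z + (c - x)); last by congr (`|_| <= _): zx; lra.
apply: congr_mod_trans zy; have := congr_mod_add (z - x) cx.
by rewrite [X in congr_mod _ _ X]addrC subrK addrCA.
Qed.

(** The sheet through [c]: the choice of values within [rho] of [c] is the local
    lift on a neighborhood where [h] stays near [c] modulo [N]. *)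
Lemma sheet_exists (T : Type) (U : set T) (h : T -> E) (c : E) :
  (forall y, U y -> congr_near N rho c (h y)) ->
  exists M : T -> E, forall y, U y -> congr_mod N (M y) (h y) /\ `|M y - c| <= rho.
Proof.
move=> Uh; suff /choice[M ?] : forall y, exists z,
    U y -> congr_mod N z (h y) /\ `|z - c| <= rho by exists M.
move=> y; have [/Uh[z zh zc]|nUy] := pselect (U y); first by exists z.
by exists 0.
Qed.

(** A sheet has jumps at most [rho], and not merely [2 rho]: the value [z]
    congruent to [h y] and within [rho] of [M x] must be [M y], because it lies
    within [2 rho] of [c] and [M y] lies within [rho] of [c]. *)
Lemma sheet_jump (T : topologicalType) (M h : T -> E) (c : E) (x : T) :
  rho + rho + rho < N ->
  (\forall y \near x, congr_mod N (M y) (h y) /\ `|M y - c| <= rho) ->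
  (\forall y \near x, congr_near N rho (h x) (h y)) ->
  \forall y \near x, `|M y - M x| <= rho.
Proof.
move=> rN Mh hh; have [Mhx Mcx] := nbhs_singleton Mh.
apply: filterS2 Mh hh => y [Mhy Mcy] /(congr_near_recenter Mhx)[z zh zx].
suff -> : M y = z by [].
apply: congr_mod_eq (congr_mod_trans Mhy (congr_mod_sym zh)) _.
by apply: le_lt_trans rN; rewrite !ler_norml in zx Mcx Mcy *; lra.
Qed.

Lemma jumps_le_cst (T : topologicalType) (c : E) :
  0 <= rho -> jumps_le [set: T] rho (fun=> c).
Proof.
move=> rho0 x _; near=> y; rewrite subrr normr0.
Unshelve. all: by end_near. Qed.

Lemma jumps_le_comp (S T : topologicalType) (a : T -> E) (p : S -> T) :
  continuous p -> jumps_le [set: T] rho a -> jumps_le [set: S] rho (a \o p).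
Proof. by move=> cp ja x _; exact: (cp x _ (ja (p x) Logic.I)). Qed.

Lemma jumps_le_paste (R : realType) (a b : R -> E) (c : R) :
  jumps_le setT rho a -> jumps_le setT rho b -> a c = b c ->
  jumps_le setT rho (fun x => if x <= c then a x else b x).
Proof.
move=> ja jb ab x _; have [xc|cx|->] := ltgtP x c.
- near=> y; rewrite ifT; first by near: y; exact: ja.
  by apply: ltW; near: y; exact: lt_nbhsl.
- near=> y; rewrite ifF; first by near: y; exact: jb.
  by apply/negbTE; rewrite -ltNge; near: y; exact: lt_nbhsr.
- near=> y; case: ifP => _; first by near: y; exact: ja.
  by rewrite ab; near: y; exact: jb.
Unshelve. all: by end_near. Qed.

End Lifts.

(** * Lifting paths, and families of paths *)

Section Real.
Variables (R : realType) (E : realDomainType) (N rho : E).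

Lemma clip_continuous (s t : R) : continuous (fun x => Num.max s (Num.min t x)).
Proof.
move=> x; apply: (@continuous_max R R (fun=> s) (fun y => Num.min t y)); first exact: cvg_cst.
by apply: (@continuous_min R R (fun=> t) id); [exact: cvg_cst|exact: cvg_id].
Qed.

(** The set of [t] such that [h] lifts over [[0, t]] propagates: near a point,
    a lift is prolonged by a translate of the sheet there. *)
Lemma path_lift (h : R -> E) (e : E) : 0 <= rho -> rho + rho + rho < N ->
  (forall x, \forall y \near x, congr_near N rho (h x) (h y)) ->
  congr_mod N e (h 0) ->
  exists a : R -> E, [/\ jumps_le setT rho a, a 0 = e &
    forall x, 0 <= x <= 1 -> congr_mod N (a x) (h x)].
Proof.
move=> rho0 rN hh eh.
pose P t := exists a : R -> E, [/\ jumps_le setT rho a, a 0 = e &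
  forall x, 0 <= x <= t -> congr_mod N (a x) (h x)].
have P0 : P 0.
  exists (fun=> e); split=> // [|x]; first exact: jumps_le_cst.
  by rewrite -eq_le => /eqP <-.
have I0 : [set` `[0 : R, 1]] 0 by rewrite /= in_itv /= lexx ler01.
have I1 : [set` `[0 : R, 1]] 1 by rewrite /= in_itv /= lexx ler01.
apply: (local_propagation (P := P) (@segment_connected R 0 1) _ I0 I1 P0).
move=> t _; have /nbhs_ballP[d /= d0 Bh] := hh t.
exists (ball t d); first exact: nbhsx_ballx.
have [M Mh] := sheet_exists Bh.
move=> t1 t2 /=; rewrite !in_itv /= => /andP[t10 _] _ Bt1 Bt2 [a [ja a0 ah]].
have [t21|t12] := leP t2 t1.
  by exists a; split=> // x /andP[x0 xt]; apply: ah; rewrite x0 (le_trans xt).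
(* [clip] retracts the line onto [[t1, t2]], where the sheet is controlled. *)
pose clip x := Num.max t1 (Num.min t2 x).
have clipB x : ball t d (clip x).
  have : t1 <= clip x <= t2 by rewrite /clip le_max lexx ge_max ge_min lexx (ltW t12).
  by move: Bt1 Bt2; rewrite -ball_normE /= !ltr_norml; lra.
have jM x : \forall y \near x, `|M (clip y) - M (clip x)| <= rho.
  suff : \forall y \near clip x, `|M y - M (clip x)| <= rho.
    exact: (@clip_continuous t1 t2 x).
  apply: sheet_jump rN _ (hh _); have : \forall y \near clip x, ball t d y.
    by apply: open_nbhs_nbhs; split; [exact: ball_open|exact: clipB].
  by apply: filterS => y; exact: Mh.
pose b x := M (clip x) + (a t1 - M t1).
have clip1 : clip t1 = t1 by rewrite /clip min_r ?(ltW t12)// maxxx.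
have jb : jumps_le setT rho b.
  by move=> x _; apply: filterS (jM x) => y; rewrite /b opprD addrACA subrr addr0.
exists (fun x => if x <= t1 then a x else b x); split; last first.
- move=> x /andP[x0 xt2]; case: leP => xt1; first by apply: ah; rewrite x0.
  have clipx : clip x = x by rewrite /clip min_r// max_r// (ltW xt1).
  have [Mx _] := Mh _ (clipB x); have [Mt1 _] := Mh _ Bt1.
  rewrite clipx in Mx; rewrite /b clipx.
  have at1 : congr_mod N (a t1) (M t1).
    by apply: congr_mod_trans (congr_mod_sym Mt1); apply: ah; rewrite t10 lexx.
  apply: congr_mod_trans Mx; have := congr_mod_add (M x - M t1) at1.
  by rewrite [X in congr_mod _ _ X]addrC subrK addrCA.
- by rewrite t10.
- by apply: jumps_le_paste => //; rewrite /b clip1 addrC subrK.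
Unshelve. all: by end_near. Qed.

Lemma ball_connected (x d : R) : connected (ball x d).
Proof.
apply/connected_intervalP => u v; rewrite -ball_normE /= => Bu Bv w uwv.
by rewrite !ltr_norml in Bu Bv *; lra.
Qed.

(** Lifts of the paths [h s], chosen separately for each [s] but with initial
    points that vary with bounded jumps, vary with bounded jumps at every time
    [t]: on a box around [(s0, t)] there is a joint sheet [M], and by uniqueness
    of lifts along each line, agreement of [L] with [M] near [s0] at one time of
    the box spreads to all its times.  Applied to a homotopy this replaces the
    lifting of the square. *)
Lemma family_lift_jumps (S : topologicalType) (h L : S -> R -> E) :
  0 <= rho -> rho + rho + rho < N ->
  (forall s t, \forall p \near (s, t), congr_near N rho (h s t) (h p.1 p.2)) ->
  (forall s, jumps_le setT rho (L s)) ->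
  (forall s t, congr_mod N (L s t) (h s t)) ->
  jumps_le setT rho (fun s => L s 0) ->
  forall t, jumps_le setT rho (fun s => L s t).
Proof.
move=> rho0 rN hh jL Lh jL0 t s0 _; have rN2 : rho + rho < N by lra.
pose P t := \forall s \near s0, `|L s t - L s0 t| <= rho.
have cR : connected [set: R] by apply/connected_intervalP.
apply: (local_propagation (P := P) cR _ (I : setT 0) (I : setT t)); last exact: jL0.
move=> {}t _; have [[U V] /= [nU /nbhs_ballP[d /= d0 BV]] UVh] := hh s0 t.
exists (ball t d); first exact: nbhsx_ballx.
have Uh p : (U `*` ball t d) p -> congr_near N rho (L s0 t) (h p.1 p.2).
  by move=> [Up Bp]; apply: congr_near_recenter (Lh _ _) (UVh p _); split=> //; exact: BV.
have [M Mh] := sheet_exists Uh.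
have hs s t' : \forall u \near t', congr_near N rho (h s t') (h s u).
  have [[A B] /= [nA nB] ABh] := hh s t'.
  by apply: filterS nB => u Bu; apply: (ABh (s, u)); split=> //; exact: nbhs_singleton nA.
have ht t' : \forall s \near s0, congr_near N rho (h s0 t') (h s t').
  have [[A B] /= [nA nB] ABh] := hh s0 t'.
  by apply: filterS nA => s As; apply: (ABh (s, t')); split=> //; exact: nbhs_singleton nB.
have jM1 s : U s -> jumps_le (ball t d) rho (fun u => M (s, u)).
  move=> Us u Bu; apply: (@sheet_jump _ N rho _ _ (h s) (L s0 t)) => //.
  have : \forall v \near u, ball t d v.
    by apply: open_nbhs_nbhs; split=> //; exact: ball_open.
  by apply: filterS => v Bv; apply: (Mh (s, v)).
have jM2 u : ball t d u -> \forall s \near s0, `|M (s, u) - M (s0, u)| <= rho.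
  move=> Bu; apply: (@sheet_jump _ N rho _ _ (h ^~ u) (L s0 t)) => //.
  by apply: filterS nU => s Us; apply: (Mh (s, u)).
have LM s u v : U s -> ball t d u -> ball t d v -> L s u = M (s, u) -> L s v = M (s, v).
  move=> Us Bu Bv LMu.
  apply: (@lift_unique _ N rho _ (ball t d) (L s) (fun w => M (s, w)) u) => //.
  - exact: ball_connected.
  - by move=> w _; exact: jL.
  - exact: jM1.
  move=> w Bw; apply: congr_mod_trans (Lh s w) (congr_mod_sym _).
  by have [] := Mh (s, w) (conj Us Bw).
have Us0 := nbhs_singleton nU.
have LM0 u : ball t d u -> L s0 u = M (s0, u).
  move=> Bu; have Bt := ballxx t d0; apply: (LM s0 t u) => //.
  have [Mt Mc] := Mh (s0, t) (conj Us0 Bt).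
  apply: congr_mod_eq (congr_mod_trans (Lh s0 t) (congr_mod_sym Mt)) _.
  by rewrite distrC; apply: le_lt_trans Mc _; apply: le_lt_trans rN2; rewrite lerDl.
move=> t1 t2 _ _ B1 B2 P1; rewrite /P.
near=> s; have Us : U s by near: s.
rewrite LM0// (LM s t1 t2)//; first by near: s; exact: jM2.
have [Mt1 _] := Mh (s, t1) (conj Us B1).
apply: congr_mod_eq (congr_mod_trans (Lh s t1) (congr_mod_sym Mt1)) _.
have PL : `|L s t1 - L s0 t1| <= rho by near: s.
have PM : `|M (s, t1) - M (s0, t1)| <= rho by near: s; exact: jM2.
by apply: le_lt_trans rN2; rewrite (LM0 t1)// !ler_norml in PL PM *; lra.
Unshelve. all: by end_near. Qed.

End Real.

(** A stand-in for boundedness of continuous functions on a segment, since a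
    function with bounded jumps may fail to be continuous. *)
Lemma jumps_le_bounded (R : realType) (E : realDomainType) (rho : E) (a : R -> E) :
  jumps_le setT rho a -> exists M, forall x, 0 <= x <= 1 -> `|a x| <= M.
Proof.
move=> ja; pose P t := exists M, forall x, 0 <= x <= t -> `|a x| <= M.
have P0 : P 0 by exists `|a 0| => x; rewrite -eq_le => /eqP <-.
have I0 : [set` `[0 : R, 1]] 0 by rewrite /= in_itv /= lexx ler01.
have I1 : [set` `[0 : R, 1]] 1 by rewrite /= in_itv /= lexx ler01.
apply: (local_propagation (P := P) (@segment_connected R 0 1) _ I0 I1 P0) => t _.
have /nbhs_ballP[d /= d0 Bt] := ja t Logic.I.
exists (ball t d); first exact: nbhsx_ballx.
move=> t1 t2 _ _ B1 B2 [M HM]; exists (Num.max M (`|a t| + rho)) => x /andP[x0 xt].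
rewrite le_max; have [xt1|t1x] := leP x t1; first by rewrite HM// x0.
apply/orP; right; rewrite -lerBlDl; apply: le_trans (lerB_dist _ _) (Bt _ _).
by move: B1 B2; rewrite -ball_normE /= !ltr_norml; lra.
Qed.

Section IntervalMaps.
Variable R : realType.

Lemma Ival_clamp_continuous : continuous (@Ival R \o @clamp R).
Proof.
move=> x; apply: continuous_comp; first exact: clamp_continuous.
exact: Ival_continuous.
Qed.

Lemma Ival_fst_continuous : continuous (fun p : unitI R * unitI R => Ival p.1).
Proof.
move=> p; apply: (@continuous_comp _ _ _ fst); first exact: cvg_fst.
exact: Ival_continuous.
Qed.

Lemma Ival_snd_continuous : continuous (fun p : unitI R * unitI R => Ival p.2).
Proof.
move=> p; apply: (@continuous_comp _ _ _ snd); first exact: cvg_snd.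
exact: Ival_continuous.
Qed.

End IntervalMaps.

(** * Loops in the cyclic closure space and their integer lifts *)

Section Zn.
Variables (n m : nat).
Hypothesis n1 : (1 < n)%N.

Lemma Zn_intP (i j : int) : i%:~R = j%:~R :> 'Z_n <-> congr_mod n%:Z i j.
Proof.
split=> [ij|[k ->]]; last first.
  by rewrite intrD -[n%:Z *~ k]mulrzl intrM -pmulrn pchar_Zp// mulr0 addr0.
have n0 : n%:Z != 0 by rewrite -lt0n ltnW.
exists ((i - j) %/ n%:Z)%Z; rewrite -mulrzr intz mulrC.
suff r0 : ((i - j) %% n%:Z)%Z = 0.
  by rewrite -[_ * _]addr0 -r0 -divz_eq addrC subrK.
have : ((i - j) %% n%:Z)%Z%:~R = 0 :> 'Z_n.
  have := congr1 (fun z : int => z%:~R : 'Z_n) (divz_eq (i - j) n%:Z).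
  by rewrite intrB ij subrr intrD intrM -pmulrn pchar_Zp// mulr0 add0r.
have := modz_ge0 (i - j) n0; have : ((i - j) %% n%:Z)%Z < n%:Z by rewrite ltz_pmod// ltz_nat ltnW.
case: ((i - j) %% n%:Z)%Z => // r; rewrite ltz_nat => rn _ /(congr1 val) /=.
by rewrite -pmulrn val_Zp_nat// modn_small// => ->.
Qed.

Lemma Zn_int_val (k : 'Z_n) : (k%:Z)%:~R = k.
Proof. by rewrite -pmulrn natr_Zp. Qed.

Lemma Zn_ball_sym (k l : 'Z_n) : Zn_ball m k l -> Zn_ball m l k.
Proof.
move=> [d /= dm <-]; exists (- d); first by rewrite /= normrN.
by rewrite mulrNz addrK.
Qed.

Lemma Zn_ball_int (i j : int) : `|j - i| <= m%:Z -> @Zn_ball n m i%:~R j%:~R.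
Proof. by move=> ij; exists (j - i) => //; rewrite intrB addrC subrK. Qed.

Lemma congr_near_Zn (i j : int) : @Zn_ball n m i%:~R j%:~R ->
  congr_near n%:Z m%:Z i j.
Proof.
move=> [d dm ij]; exists (i + d); last by rewrite addrC addKr.
by apply/Zn_intP; rewrite intrD.
Qed.

(** Continuity into [(Z_n, c_m)] is a pointwise condition because [Zn_ball m k]
    is the least neighborhood of [k], the relation being symmetric. *)
Lemma Zn_continuousP (T : topologicalType) (g : T -> 'Z_n) :
  @ccontinuous (top_closure T) (Zn_closure n m) g <->
  forall x, \forall y \near x, Zn_ball m (g x) (g y).
Proof.
split=> [cg x|gb A _ [x clx <-]].
- apply: contrapT => nb.
  pose A := [set y | ~ Zn_ball m (g x) (g y)].
  have clA : closure A x.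
    move=> B nB; apply: contrapT => AB; apply: nb; apply: filterS nB => y By.
    by apply: contrapT => nby; apply: AB; exists y.
  have [_ [y Ay <-] /Zn_ball_sym] : @cl (Zn_closure n m) (g @` A) (g x).
    by apply: cg; exists x.
  exact: Ay.
- have [y [Ay xy]] := clx _ (gb x).
  by exists (g y); [exists y|exact: Zn_ball_sym].
Qed.

Lemma jumps_le_continuous (T : topologicalType) (a : T -> int) :
  jumps_le setT m%:Z a ->
  @ccontinuous (top_closure T) (Zn_closure n m) (fun x => (a x)%:~R).
Proof.
move=> ja; apply/Zn_continuousP => x; apply: filterS (ja x Logic.I) => y.
exact: Zn_ball_int.
Qed.

Variable R : realType.
Hypothesis mn : m%:Z + m%:Z + m%:Z < n%:Z.

Local Notation loopZn := (@loop R (Zn_closure n m) 0).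

(** Lifts are functions on the whole line, extended constantly outside the unit
    interval, so that the lemmas on [R] apply to them. *)
Definition lifts (a : R -> int) (v : unitI R -> 'Z_n) : Prop :=
  jumps_le setT m%:Z a /\ forall x, (a x)%:~R = v (clamp x).

Lemma lift_exists (v : unitI R -> 'Z_n) (e : int) :
  @ccontinuous (top_closure (unitI R)) (Zn_closure n m) v -> e%:~R = v (I0 R) ->
  exists2 a, lifts a v & a 0 = e.
Proof.
move=> /Zn_continuousP cv e0.
have [|||a [ja a0 av]] := @path_lift R _ n%:Z m%:Z (fun x => (v (clamp x))%:Z) e _ mn.
- by [].
- move=> x; have : \forall y \near x, Zn_ball m (v (clamp x)) (v (clamp y)).
    exact: (@clamp_continuous R x _ (cv (clamp x))).
  by apply: filterS => y vxy; apply: congr_near_Zn; rewrite !Zn_int_val.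
- by apply/Zn_intP; rewrite Zn_int_val e0 clamp_le0.
exists (a \o (@Ival R \o @clamp R)); last by rewrite /= clamp_le0.
split; first by apply: jumps_le_comp => //; exact: Ival_clamp_continuous.
move=> x; have /Zn_intP -> := av _ (Ival_itv (clamp x)).
by rewrite Zn_int_val clampK.
Qed.

(** The endpoints of the lifts of [t |-> H (s, t)] form, as [s] varies, a lift of
    [w] with the same initial point as [b], hence [b] itself; at [s = 1] the path
    is constant, so its lift still ends at [a 1]. *)
Lemma lift_end_homotopic (v w : loopZn) (a b : R -> int) :
  lifts a v -> lifts b w -> a 0 = b 0 -> homotopic v w -> a 1 = b 1.
Proof.
move=> [ja av] [jb bw] ab0 [H [/ccontinuous_prodE /Zn_continuousP cH H0 H1 Hl Hr]].
pose h s t : int := (H (clamp s, clamp t) : 'Z_n)%:Z.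
(* [L0 s] lifts the path [t |-> H (s, t)] from the point [a s]. *)
have /choice[L0 L0P] : forall s : R, exists b : R -> int,
    lifts b (fun t => H (clamp s, t)) /\ b 0 = a s.
  move=> s; have [||L LH L0] := @lift_exists (fun t => H (clamp s, t)) (a s).
  + apply/Zn_continuousP => t; have := cH (clamp s, t).
    move=> [[A B] /= [nA nB] AB]; apply: filterS nB => u Bu.
    by apply: (AB (clamp s, u)); split=> //; exact: nbhs_singleton nA.
  + by rewrite av H0.
  + by exists L.
have n2m : m%:Z + m%:Z < n%:Z by apply: le_lt_trans mn; rewrite lerDl.
have jL1 : jumps_le setT m%:Z (fun s => L0 s 1).
  apply: (@family_lift_jumps R _ n%:Z m%:Z R h) => //.
  - move=> s t; have cc : {for (s, t), continuous (fun p : R * R => (clamp p.1, clamp p.2))}.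
      apply: (@cvg_pair _ _ _ _ (nbhs (clamp s)) (nbhs (clamp t))).
        by apply: continuous_comp; [exact: cvg_fst|exact: clamp_continuous].
      by apply: continuous_comp; [exact: cvg_snd|exact: clamp_continuous].
    have : \forall p \near (s, t),
        Zn_ball m (H (clamp s, clamp t)) (H (clamp p.1, clamp p.2)).
      exact: (cc _ (cH (clamp s, clamp t))).
    by apply: filterS => p Hp; apply: congr_near_Zn; rewrite !Zn_int_val.
  - by move=> s; have [[]] := L0P s.
  - by move=> s t; have [[_ LH] _] := L0P s; apply/Zn_intP; rewrite LH Zn_int_val.
  - by congr jumps_le: ja; apply/funext => s; have [_ ->] := L0P s.
have cR : connected [set: R] by apply/connected_intervalP.
(* On the two sides of the square [H] is constantly 0, so the lifts do not move. *)
have constant s : (forall t, H (clamp s, t) = 0) -> L0 s 1 = a s.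
  move=> Hs; have [[jL LH] <-] := L0P s.
  apply: (@lift_unique _ n%:Z m%:Z R setT (L0 s) (fun=> L0 s 0) 0) => //.
    exact: jumps_le_cst.
  move=> x _.
  by apply/Zn_intP; rewrite !LH !Hs.
have <- : L0 1 1 = a 1 by apply: constant => t; rewrite clamp_ge1.
apply: (@lift_unique _ n%:Z m%:Z R setT (fun s => L0 s 1) b 0) => //.
- by move=> x _; apply/Zn_intP; have [[_ ->] _] := L0P x; rewrite bw (clamp_ge1 (lexx _)) H1.
- by rewrite -ab0; apply: constant => t; rewrite clamp_le0.
Qed.

End Zn.

(** * Homotopies between lifts with the same ends *)

Section Nonexpansive.
Variables (T : topologicalType) (E : realDomainType) (rho : E).

Lemma jumps_le_weaken (sigma : E) (a : T -> E) :
  sigma <= rho -> jumps_le setT sigma a -> jumps_le setT rho a.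
Proof. by move=> sr ja x Ax; apply: filterS (ja x Ax) => y /le_trans; exact. Qed.

Lemma jumps_le_max (a b : T -> E) : jumps_le setT rho a -> jumps_le setT rho b ->
  jumps_le setT rho (fun x => Num.max (a x) (b x)).
Proof.
move=> ja jb x Ax; apply: filterS2 (ja x Ax) (jb x Ax) => y.
rewrite !ler_norml => axy bxy.
by case: (leP (a y)) => ?; case: (leP (a x)) => ?; lra.
Qed.

Lemma jumps_le_min (a b : T -> E) : jumps_le setT rho a -> jumps_le setT rho b ->
  jumps_le setT rho (fun x => Num.min (a x) (b x)).
Proof.
move=> ja jb x Ax; apply: filterS2 (ja x Ax) (jb x Ax) => y.
rewrite !ler_norml => axy bxy.
by case: (leP (a y)) => ?; case: (leP (a x)) => ?; lra.
Qed.

End Nonexpansive.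

Lemma jumps_le_floor (R : realType) (T : topologicalType) (g : T -> R) :
  continuous g -> jumps_le setT (1 : int) (fun x => Num.floor (g x)).
Proof.
move=> cg x _; have /cvgrPdist_lt /(_ 1 ltr01) := cg x.
apply: filterS => y; have := floor_itv (g x); rewrite ltr_norml => fx gxy.
rewrite ler_distl floor_ge_int -[X in _ && X]ltzD1 floor_lt_int.
by move: fx; rewrite !intrD intrN => fx; apply/andP; split; lra.
Qed.

Section LoopsZn.
Variables (R : realType) (n m : nat).
Hypothesis m1 : (1 <= m)%N.

(** Straight lines are not available between integer functions: rounding a
    convex combination may produce a jump of [m + 1].  Minimum and maximum are
    1-Lipschitz for the sup norm, so they preserve the bound [m].  With an
    integer level [up t] rising from [- M] past [M], where [M] bounds [a] and
    [b], [max (min a (up (1 - t))) (min b (up t))] starts at [a] and ends at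
    [b]. *)
Lemma lift_homotopic (v w : @loop R (Zn_closure n m) 0) (a b : R -> int) :
  lifts m a v -> lifts m b w -> a 0 = b 0 -> a 1 = b 1 -> homotopic v w.
Proof.
move=> [ja av] [jb bw] ab0 ab1.
have [Ma HMa] := jumps_le_bounded ja; have [Mb HMb] := jumps_le_bounded jb.
pose M : int := Num.max Ma Mb.
have aM s : `|a (Ival s)| <= M by rewrite le_max HMa ?Ival_itv.
have bM s : `|b (Ival s)| <= M by rewrite le_max HMb ?Ival_itv ?orbT.
have M0 : 0 <= M by apply: le_trans (aM (I0 R)).
pose up (t : R) : int := Num.floor (M%:~R * (4 * t - 1)).
have up_lo : up 0 = - M by rewrite /up mulr0 sub0r mulrN1 -intrN intrKfloor.
(* The slope [4 M] makes one of [up t] and [up (1 - t)] at least [M] at every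
   time, so that the homotopy is fixed wherever [a] and [b] agree. *)
have up_hi t : 2^-1 <= t -> M <= up t.
  move=> t2; rewrite floor_ge_int ler_peMr ?ler0z//; lra.
pose K s t := Num.max (Num.min (a s) (up (1 - t))) (Num.min (b s) (up t)).
have Kab s t : 0 <= s <= 1 -> a s = b s -> K s t = a s.
  move=> /HMa as01 abs; have {as01} : a s <= M.
    by apply: le_trans (ler_norm _) (le_trans as01 _); rewrite le_max lexx.
  rewrite /K -abs => asM; have [t2|t2] := leP 2^-1 t.
    have := up_hi _ t2 => h; rewrite [Num.min _ (up t)]min_l ?max_r//; last by lra.
    by rewrite ge_min lexx.
  have h : M <= up (1 - t) by apply: up_hi; lra.
  by rewrite [Num.min _ (up (1 - t))]min_l ?max_l//; [rewrite ge_min lexx|lra].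
exists (fun p => (K (Ival p.1) (Ival p.2))%:~R); split.
- apply/ccontinuous_prodE/jumps_le_continuous.
  have cI1 := @Ival_fst_continuous R; have cI2 := @Ival_snd_continuous R.
  have jup (f : unitI R * unitI R -> R) : continuous f ->
      jumps_le setT m%:Z (fun p => up (f p)).
    move=> cf; apply: (@jumps_le_weaken _ _ _ 1) => //; apply: jumps_le_floor => p.
    apply: cvgM; first exact: cvg_cst.
    by apply: cvgB; [apply: cvgM; [exact: cvg_cst|exact: cf]|exact: cvg_cst].
  apply: jumps_le_max; apply: jumps_le_min; try exact: jumps_le_comp cI1 _.
  + by apply: jup => p; apply: cvgB; [exact: cvg_cst|exact: cI2].
  + exact: jup.
- move=> s; have := bM s; have := aM s; rewrite !ler_norml => aMs bMs.
  rewrite -(clampK s) -av clampK /K Ival_I0 subr0 up_lo.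
  have h := up_hi 1 _; rewrite min_l; last by apply: le_trans (h _); lra.
  by rewrite max_l// ge_min; lra.
- move=> s; have := bM s; have := aM s; rewrite !ler_norml => aMs bMs.
  rewrite -(clampK s) -bw clampK /K Ival_I1 subrr up_lo.
  have h := up_hi 1 _; rewrite [Num.min (b _) _]min_l; last by apply: le_trans (h _); lra.
  by rewrite max_r// ge_min; lra.
- by move=> t; rewrite Kab ?Ival_I0 ?lexx ?ler01// av clamp_le0// loop0.
- by move=> t; rewrite Kab ?Ival_I1 ?lexx ?ler01// av clamp_ge1// loop1.
Qed.

End LoopsZn.

(** * Loops in the circle and their real lifts *)

Lemma ccontinuous_continuous (S T : topologicalType) (f : S -> T) :
  @ccontinuous (top_closure S) (top_closure T) f -> continuous f.
Proof.
move=> cf x B nB; apply: contrapT => nfB.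
pose A := [set y | ~ B (f y)].
have clA : closure A x.
  move=> C nC; apply: contrapT => AC; apply: nfB; apply: (filterS _ nC) => y Cy.
  by apply: contrapT => nBy; apply: AC; exists y.
have [|_ [[y Ay <-]]] := cf A (f x) _ B nB; first by exists x.
exact: Ay.
Qed.

Section CircleLoops.
Variable R : realType.
Local Notation loopS1 := (@loop R (circle_closure R) (to_circle 0)).

Lemma to_circle_congr (s t : R) : to_circle s = to_circle t <-> congr_mod 1 s t.
Proof.
rewrite to_circleP; split=> -[k]; first by move=> st; exists k; lra.
by move=> ->; exists k; lra.
Qed.

Lemma to_circle_continuous : continuous (@to_circle R).
Proof. exact: pi_continuous. Qed.

(** The saturation of an open set is the union of its integer translates. *)
Lemma to_circle_open (x : R) (U : set R) :
  nbhs x U -> nbhs (to_circle x) (@to_circle R @` U).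
Proof.
move=> nU; apply: (@filterS _ _ _ (@to_circle R @` interior U)).
  by apply: image_subset; exact: interior_subset.
apply: open_nbhs_nbhs; split; last by exists x.
suff : open (@to_circle R @^-1` (@to_circle R @` interior U)) by [].
rewrite openE => y [u Uu /to_circleP[k uy]].
have -> : y = u - k%:~R by lra.
have cs : {for u - k%:~R, continuous (fun z : R => z + k%:~R)}.
  by apply: cvgD; [exact: cvg_id|exact: cvg_cst].
have : \forall z \near u - k%:~R, interior U (z + k%:~R).
  apply: (cs (interior U)); rewrite subrK.
  by apply: open_nbhs_nbhs; split=> //; exact: open_interior.
apply: filterS => z Uz; exists (z + k%:~R) => //.
by apply/to_circleP; exists k; rewrite addrC addKr.
Qed.

(** A lift [b] with jumps at most [1/4] is continuous: for [y] near [x],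
    continuity of [v] gives a representative of [v y] arbitrarily close to
    [b x]; it differs from [b y] by an integer of size at most [1/2], so it is
    [b y]. *)
Lemma circle_lift_exists (v : loopS1) : exists a : R -> R,
  [/\ continuous a, a 0 = 0 & forall x, to_circle (a x) = v (clamp x)].
Proof.
have cv := ccontinuous_continuous (loop_continuous v).
pose h (x : R) : R := repr (v (clamp x) : circle R).
have hE x : to_circle (h x) = v (clamp x) by rewrite /to_circle reprK.
have hh (eps : R) x : 0 < eps -> \forall y \near x, congr_near 1 eps (h x) (h y).
  move=> eps0.
  have : \forall y \near x, (@to_circle R @` ball (h x) eps) (v (clamp y)).
    have := @to_circle_open (h x) _ (nbhsx_ballx (h x) eps eps0); rewrite hE.
    by move=> /cv; exact: (@clamp_continuous R x).
  apply: filterS => y [u]; rewrite -ball_normE /= -hE => xu /to_circle_congr uy.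
  by exists u => //; rewrite distrC ltW.
have [||||a [ja a0 av]] := @path_lift R _ 1 4^-1 h 0.
- by rewrite invr_ge0.
- by lra.
- by move=> x; apply: hh; rewrite invr_gt0.
- by apply/to_circle_congr; rewrite hE clamp_le0// loop0.
pose b x := a (Ival (clamp x)).
have jb : jumps_le setT 4^-1 b by apply: jumps_le_comp ja; exact: Ival_clamp_continuous.
have bh x : congr_mod 1 (b x) (h x).
  have := av _ (Ival_itv (clamp x)); rewrite -/(b x) => /to_circle_congr bx.
  by apply/to_circle_congr; rewrite bx !hE clampK.
exists b; split; last by move=> x; rewrite -hE; exact/to_circle_congr.
  move=> x; apply/cvgrPdist_lt => eps eps0.
  have eps'0 : 0 < Num.min (eps / 2) 4^-1 by rewrite lt_min; lra.
  apply: filterS2 (jb x Logic.I) (hh _ x eps'0) => y bxy.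
  move=> /(congr_near_recenter (bh x))[z zh]; rewrite le_min => /andP[zx zx4].
  have <- : z = b y.
    apply: congr_mod_eq (congr_mod_trans zh (congr_mod_sym (bh y))) _.
    by rewrite !ler_norml in bxy zx4; rewrite ltr_norml; lra.
  by rewrite distrC; apply: le_lt_trans zx _; lra.
by rewrite /b clamp_le0.
Qed.

Lemma circle_lift_homotopic (v w : loopS1) (a b : R -> R) :
  continuous a -> continuous b ->
  (forall x, to_circle (a x) = v (clamp x)) ->
  (forall x, to_circle (b x) = w (clamp x)) ->
  a 0 = b 0 -> a 1 = b 1 -> homotopic v w.
Proof.
move=> ca cb av bw ab0 ab1.
exists (fun p => to_circle ((1 - Ival p.2) * a (Ival p.1) + Ival p.2 * b (Ival p.1))).
split=> [|s|s|t|t].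
- apply/ccontinuous_prodE; apply: continuous_ccontinuous => p.
  apply: continuous_comp; last exact: to_circle_continuous.
  have c1 := @Ival_fst_continuous R p; have c2 := @Ival_snd_continuous R p.
  apply: cvgD; apply: cvgM; [|exact: continuous_comp c1 (ca _)|exact: c2|].
    by apply: cvgB; [exact: cvg_cst|exact: c2].
  exact: continuous_comp c1 (cb _).
- by rewrite Ival_I0 subr0 mul1r mul0r addr0 av clampK.
- by rewrite Ival_I1 subrr mul1r mul0r add0r bw clampK.
- by rewrite Ival_I0 -ab0 -mulrDl subrK mul1r av clamp_le0// loop0.
- by rewrite Ival_I1 -ab1 -mulrDl subrK mul1r av clamp_ge1// loop1.
Qed.

End CircleLoops.

(** * The rounding map *)

Section Rounding.
Variables (R : realType) (n m : nat) (f : circle R -> 'Z_n).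
Hypotheses (n1 : (1 < n)%N) (m1 : (1 <= m)%N).
Hypothesis fE : forall (i : int) (t : R),
  (2 * i - 1)%:~R / (2 * n)%:R <= t < (2 * i + 1)%:~R / (2 * n)%:R ->
  f (to_circle t) = i%:~R.

Lemma round_floor (t : R) : f (to_circle t) = (Num.floor (n%:R * t + 2^-1))%:~R.
Proof.
apply: fE; have := floor_itv (n%:R * t + 2^-1).
have n0 : 0 < n%:R :> R by rewrite ltr0n ltnW.
rewrite natrM ler_pdivrMr ?ltr_pdivlMr ?mulr_gt0// !(intrB, intrD, intrM).
by move=> /andP[t1 t2]; apply/andP; split; lra.
Qed.

Lemma floor_lift_jumps (a : R -> R) : continuous a ->
  jumps_le setT m%:Z (fun x => Num.floor (n%:R * a x + 2^-1)).
Proof.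
move=> ca; apply: (@jumps_le_weaken _ _ _ 1) => //; apply: jumps_le_floor => x.
by apply: cvgD; [apply: cvgM; [exact: cvg_cst|exact: ca]|exact: cvg_cst].
Qed.

Lemma floor_lift_int (k : int) :
  Num.floor (n%:R * k%:~R + 2^-1 : R) = n%:Z * k.
Proof. by apply: floor_def; rewrite !(intrD, intrM) -!pmulrn; apply/andP; split; lra. Qed.

Lemma round_continuous : @ccontinuous (circle_closure R) (Zn_closure n m) f.
Proof.
apply/(@Zn_continuousP n m (circle R)) => q.
have -> : q = to_circle (repr q) by rewrite /to_circle reprK.
set x := repr q.
have /to_circle_open : \forall y \near x, Zn_ball m (f (to_circle x)) (f (to_circle y)).
  have := @floor_lift_jumps id (fun y => cvg_id) x Logic.I.
  by apply: filterS => y; rewrite !round_floor; exact: Zn_ball_int.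
by apply: filterS => _ [y fy <-].
Qed.

End Rounding.

Lemma eq_homotopic (R : realType) (X : closureSpace) (x0 : X) (v w : loop R x0) :
  v =1 w -> homotopic v w.
Proof.
move=> vw; have [H [cH H0 H1 Hl Hr]] := homotopic_refl v.
by exists H; split=> // s; rewrite H1 vw.
Qed.

(** * The isomorphism *)

Theorem theorem4p51 (R : realType) (m n : nat) (f : circle R -> 'Z_n) :
  (1 <= m)%N -> m%:R < n%:R / 3 :> R ->
  (forall (i : int) (t : R),
     (2 * i - 1)%:~R / (2 * n)%:R <= t < (2 * i + 1)%:~R / (2 * n)%:R ->
     f (to_circle t) = i%:~R) ->
  exists (cf : @ccontinuous (circle_closure R) (Zn_closure n m) f)
         (f0 : f (to_circle 0) = 0),
    group_isomorphism (@pi1_map R (circle_closure R) (Zn_closure n m) f cf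
      (to_circle 0) 0 f0).
Proof.
move=> m1 mn fE.
have mn3 : (m + m + m < n)%N.
  by rewrite -(ltr_nat R) !natrD; move: mn; rewrite ltr_pdivlMr//; lra.
have n1 : (1 < n)%N by apply: leq_trans mn3; rewrite ltnS !addn_gt0 m1.
have mnz : m%:Z + m%:Z + m%:Z < n%:Z by rewrite -!PoszD ltz_nat.
have cf := round_continuous n1 m1 fE.
have floor0 : Num.floor (n%:R * 0 + 2^-1 : R) = 0.
  by have := @floor_lift_int R n 0; rewrite mulr0z !mulr0.
have f0 : f (to_circle 0) = 0 by rewrite (round_floor n1 fE) floor0.
exists cf, f0; split.
- elim/quotW => v; elim/quotW => w; rewrite [(_ * _)%g]pi1_mulE !pi1_mapE.
  rewrite [RHS]pi1_mulE; apply/pi1P/eq_homotopic => s /=.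
  by rewrite /concat_fun; case: ifP.
have lift_round (v : @loop R (circle_closure R) (to_circle 0)) (a : R -> R) :
    continuous a -> (forall x, to_circle (a x) = v (clamp x)) ->
    lifts m (fun x => Num.floor (n%:R * a x + 2^-1)) (comp_loop cf f0 v).
  move=> ca av; split; first exact: floor_lift_jumps.
  by move=> x; rewrite -(round_floor n1 fE) av.
rewrite -setTT_bijective; split=> //.
- elim/quotW => v; elim/quotW => w _ _; rewrite !pi1_mapE => /pi1P fvw; apply/pi1P.
  have [a [ca a0 av]] := circle_lift_exists v.
  have [b [cb b0 bw]] := circle_lift_exists w.
  apply: (circle_lift_homotopic ca cb av bw); first by rewrite a0 b0.
  have end_int (u : @loop R (circle_closure R) (to_circle 0)) (c : R -> R) :
      (forall x, to_circle (c x) = u (clamp x)) -> exists k : int, c 1 = k%:~R.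
    move=> cu; have /to_circleP[k] : to_circle (c 1) = to_circle 0.
      by rewrite cu clamp_ge1// loop1.
    by rewrite subr0; exists k.
  have := lift_end_homotopic n1 mnz (lift_round v a ca av) (lift_round w b cb bw).
  rewrite a0 b0 => /(_ erefl fvw).
  have [k ->] := end_int v a av; have [l ->] := end_int w b bw.
  rewrite !floor_lift_int => /mulfI -> //.
  by rewrite -lt0n ltnW.
- elim/quotW => w _.
  have [||a [ja aw] a0] := @lift_exists n m n1 R mnz w 0.
  + exact: loop_continuous.
  + by rewrite loop0.
  have [k a1] : exists k : int, a 1 = n%:Z * k.
    have /(Zn_intP n1)[k] : (a 1)%:~R = 0%:~R :> 'Z_n by rewrite aw clamp_ge1// loop1.
    by rewrite add0r -mulrzl intz mulrC; exists k.
  (* The loop winding [k] times around the circle is the preimage. *)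
  pose b (x : R) := k%:~R * x.
  have cb : continuous b by move=> x; apply: cvgM; [exact: cvg_cst|exact: cvg_id].
  have cv : @ccontinuous (top_closure (unitI R)) (circle_closure R)
      (fun s => to_circle (b (Ival s))).
    apply: continuous_ccontinuous => s.
    apply: continuous_comp; last exact: to_circle_continuous.
    by apply: continuous_comp; [exact: Ival_continuous|exact: cb].
  have v0 : to_circle (b (Ival (I0 R))) = to_circle 0 by rewrite Ival_I0 /b mulr0.
  have v1 : to_circle (b (Ival (I1 R))) = to_circle 0.
    by apply/to_circleP; exists k; rewrite Ival_I1 /b mulr1 subr0.
  pose v := Loop cv v0 v1; exists (\pi_(@pi1 R (circle_closure R) (to_circle 0)) v)%qT => //.
  rewrite pi1_mapE; apply/pi1P.
  have cc : continuous (b \o (@Ival R \o @clamp R)).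
    by move=> x; apply: continuous_comp; [exact: Ival_clamp_continuous|exact: cb].
  have := lift_round v _ cc (fun=> erefl); move=> lv.
  apply: (lift_homotopic m1 lv (conj ja aw)).
  + by rewrite /= clamp_le0// Ival_I0 /b mulr0 floor0 a0.
  + by rewrite /= clamp_ge1// Ival_I1 /b mulr1 floor_lift_int a1.
Qed.
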